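(* Let $\mathcal{T}$ be a class of finite undirected trees. The following are equivalent: (1) $\mathcal{T}$ is $\mathrm{MSO}_1$-orderable; (2) $\mathcal{T}$ is $\mathrm{MSO}_2$-orderable; (3) $\mathcal{T}$ has property $\mathsf{SEP}$; (4) there is $d\in\mathbb{N}$ such that every tree in $\mathcal{T}$ has maximal degree at most $d$.
   Context: Graphs are finite, simple, loop-free, undirected. For $G=\langle V,E\rangle$: $\lfloor G\rfloor=\langle V,\mathrm{edg}\rangle$ (universe $V$, edge relation) and $\lceil G\rceil=\langle V\cup E,\mathrm{inc}\rangle$ (universe vertices and edges, $\mathrm{inc}\subseteq V\times E$ incidence). An MSO-formula $\varphi(x,y;Z_0,\dots,Z_{n-1})$ defines an order on a class $\mathcal{C}$ of structures if for every non-empty $\mathfrak{A}\in\mathcal{C}$ there are $P_0,\dots,P_{n-1}\subseteq A$ such that $\{(a,b):\mathfrak{A}\models\varphi(a,b;\bar P)\}$ is a linear order on $A$; $\mathcal{C}$ is MSO-orderable if such $\varphi$ exists. A class $\mathcal{C}$ of graphs is $\mathrm{MSO}_1$-orderable if $\{\lfloor G\rfloor:G\in\mathcal{C}\}$ is MSO-orderable and $\mathrm{MSO}_2$-orderable if $\{\lceil G\rceil:G\in\mathcal{C}\}$ is MSO-orderable. $\mathrm{Sep}(G,k)$ is the maximum over vertex sets $S$ with $|S|\le k$ of the number of connected components of $G-S$. A class $\mathcal{C}$ has property $\mathsf{SEP}(f)$ for $f:\mathbb{N}\to\mathbb{N}$ if $\mathrm{Sep}(G,k)\le f(k)$ for all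 $G\in\mathcal{C}$ and $k\in\mathbb{N}$; it has property $\mathsf{SEP}$ if it has $\mathsf{SEP}(f)$ for some $f$. *)

(* Defs.v *)
From mathcomp Require Import all_boot.
Set Implicit Arguments. Unset Strict Implicit. Unset Printing Implicit Defensive.

Definition is_graph (T : finType) (e : rel T) : Prop :=
  symmetric e /\ irreflexive e.

Definition is_tree (T : finType) (e : rel T) : Prop :=
  [/\ is_graph e, 0 < #|T|,
      (forall x y : T, connect e x y) &
      (forall c : seq T, ucycle e c -> size c < 3)].

Definition graph_class := forall T : finType, rel T -> Prop.

Inductive mso : Type :=
| MRel (x y : nat)
| MEq  (x y : nat)
| MIn  (x X : nat)
| MNot (f : mso)
| MAnd (f g : mso)
| MEx1 (x : nat) (f : mso)
| MEx2 (X : nat) (f : mso).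

Definition upd (B : Type) (r : nat -> B) (i : nat) (b : B) : nat -> B :=
  fun j => if j == i then b else r j.

Fixpoint sat (A : finType) (R : rel A) (rho : nat -> A) (sigma : nat -> {set A})
    (f : mso) : Prop :=
  match f with
  | MRel x y => R (rho x) (rho y)
  | MEq x y => rho x = rho y
  | MIn x X => rho x \in sigma X
  | MNot g => ~ sat R rho sigma g
  | MAnd g h => sat R rho sigma g /\ sat R rho sigma h
  | MEx1 x g => exists a : A, sat R (upd rho x a) sigma g
  | MEx2 X g => exists S : {set A}, sat R rho (upd sigma X S) g
  end.

Fixpoint fv1 (f : mso) : seq nat :=
  match f with
  | MRel x y => [:: x; y]
  | MEq x y => [:: x; y]
  | MIn x _ => [:: x]
  | MNot g => fv1 g
  | MAnd g h => fv1 g ++ fv1 h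
  | MEx1 x g => [seq i <- fv1 g | i != x]
  | MEx2 _ g => fv1 g
  end.

Definition env2 (A : Type) (a b : A) : nat -> A :=
  fun i => if i == 0 then a else b.

Definition linear_order (A : Type) (r : A -> A -> Prop) : Prop :=
  [/\ (forall a, r a a),
      (forall a b, r a b -> r b a -> a = b),
      (forall a b c, r a b -> r b c -> r a c) &
      (forall a b, r a b \/ r b a)].

(* phi(x,y; Z_i ...) with free first-order variables among x = 0, y = 1 and
   set parameters Z_i = set variable i. *)
Definition defines_order_on (A : finType) (R : rel A) (phi : mso) : Prop :=
  exists sigma : nat -> {set A},
    linear_order (fun a b : A => sat R (env2 a b) sigma phi).

Definition is_edge (T : finType) (e : rel T) (s : {set T}) : bool :=
  [exists u : T, exists v : T, e u v && (s == [set u; v])].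

Definition edge_type (T : finType) (e : rel T) : finType :=
  {s : {set T} | is_edge e s}.

Definition inc_univ (T : finType) (e : rel T) : finType :=
  (T + edge_type e)%type.

Definition inc_rel (T : finType) (e : rel T) : rel (inc_univ e) :=
  fun x y => match x, y with
             | inl v, inr s => v \in val s
             | _, _ => false
             end.

Definition MSO1_orderable (C : graph_class) : Prop :=
  exists phi : mso, all (fun i => i <= 1) (fv1 phi) /\
    forall (T : finType) (e : rel T), C T e -> 0 < #|T| ->
      defines_order_on e phi.

Definition MSO2_orderable (C : graph_class) : Prop :=
  exists phi : mso, all (fun i => i <= 1) (fv1 phi) /\
    forall (T : finType) (e : rel T), C T e -> 0 < #|inc_univ e| ->
      defines_order_on (@inc_rel T e) phi.

Definition del_rel (T : finType) (e : rel T) (S : {set T}) : rel T :=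
  fun x y => [&& x \notin S, y \notin S & e x y].

Definition ncomp_del (T : finType) (e : rel T) (S : {set T}) : nat :=
  n_comp (del_rel e S) (~: S).

Definition Sep (T : finType) (e : rel T) (k : nat) : nat :=
  \max_(S : {set T} | #|S| <= k) ncomp_del e S.

Definition has_SEP_f (C : graph_class) (f : nat -> nat) : Prop :=
  forall (T : finType) (e : rel T), C T e -> forall k : nat, Sep e k <= f k.

Definition has_SEP (C : graph_class) : Prop := exists f, has_SEP_f C f.

Definition degree (T : finType) (e : rel T) (v : T) : nat := #|[set u | e v u]|.

Definition max_degree (T : finType) (e : rel T) : nat := \max_(v : T) degree e v.

Definition bounded_degree (C : graph_class) : Prop :=
  exists d : nat, forall (T : finType) (e : rel T), C T e -> max_degree e <= d.

(* Main.v *)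
Require Import Defs.
From mathcomp Require Import all_boot.
Set Implicit Arguments. Unset Strict Implicit. Unset Printing Implicit Defensive.

(* (1) => (2) holds for all graphs: an order on the vertices yields an order on
   the edges, two edges being compared at the largest vertex of their symmetric
   difference.
   (2) => (3) holds for all graphs, by a Feferman-Vaught argument. Delete a set
   S of k vertices; what remains of the incidence structure, apart from a core
   whose size is bounded in terms of k, falls into pieces, one for each component
   of G - S, with no relation between distinct pieces. There are finitely many
   types of quantifier rank m of a piece with its parameters, a marked element
   and its adjacency to the core. If there are too many components, two pieces
   with marked elements a and b have the same type, so that exchanging them shows
   that phi(a, b) is equivalent to phi(b, a), which is absurd for an order.
   (3) => (4): deleting a vertex of a tree separates its neighbours.
   (4) => (1): root the tree and number the children of each vertex from 0 to
   d - 1. The depth modulo 3, given by three parameters, makes the parent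
   relation definable; d more parameters hold the numbers. The order is the
   lexicographic order of the sequences of numbers on the path from the root. *)

(** * Boolean semantics of formulas *)

Fixpoint satb (A : finType) (R : rel A) (rho : nat -> A)
    (sigma : nat -> {set A}) (f : mso) : bool :=
  match f with
  | MRel x y => R (rho x) (rho y)
  | MEq x y => rho x == rho y
  | MIn x X => rho x \in sigma X
  | MNot g => ~~ satb R rho sigma g
  | MAnd g h => satb R rho sigma g && satb R rho sigma h
  | MEx1 x g => [exists a : A, satb R (upd rho x a) sigma g]
  | MEx2 X g => [exists S : {set A}, satb R rho (upd sigma X S) g]
  end.

Lemma satP (A : finType) (R : rel A) rho sigma f :
  reflect (sat R rho sigma f) (satb R rho sigma f).
Proof.
elim: f rho sigma => /= [x y|x y|x X|g IH|g IHg h IHh|x g IH|X g IH] rho sigma.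
- exact: idP.
- exact: eqP.
- exact: idP.
- by apply: (iffP negP) => H /IH.
- by apply: (iffP andP) => -[/IHg ? /IHh].
- by apply: (iffP existsP) => -[a /IH]; exists a.
- by apply: (iffP existsP) => -[a /IH]; exists a.
Qed.

Definition MOr f g := MNot (MAnd (MNot f) (MNot g)).
Definition MImp f g := MNot (MAnd f (MNot g)).
Definition MAll1 x f := MNot (MEx1 x (MNot f)).
Definition MAll2 X f := MNot (MEx2 X (MNot f)).
Definition MFalse := MAnd (MEq 0 0) (MNot (MEq 0 0)).
Definition MBigOr (s : seq mso) := foldr MOr MFalse s.

Section Connectives.
Variables (A : finType) (R : rel A).
Implicit Types (rho : nat -> A) (sigma : nat -> {set A}).

Lemma satb_and rho sigma f g :
  satb R rho sigma (MAnd f g) = satb R rho sigma f && satb R rho sigma g.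
Proof. by []. Qed.

Lemma satb_ex1 rho sigma x f :
  satb R rho sigma (MEx1 x f) = [exists a, satb R (upd rho x a) sigma f].
Proof. by []. Qed.

Lemma satb_or rho sigma f g :
  satb R rho sigma (MOr f g) = satb R rho sigma f || satb R rho sigma g.
Proof. by rewrite /= negb_and !negbK. Qed.

Lemma satb_imp rho sigma f g :
  satb R rho sigma (MImp f g) = (satb R rho sigma f ==> satb R rho sigma g).
Proof. by rewrite /= negb_and negbK implybE. Qed.

Lemma satb_all1 rho sigma x f :
  satb R rho sigma (MAll1 x f) = [forall a, satb R (upd rho x a) sigma f].
Proof. by rewrite /= negb_exists; apply: eq_forallb => a; rewrite negbK. Qed.

Lemma satb_all2 rho sigma X f :
  satb R rho sigma (MAll2 X f) = [forall S, satb R rho (upd sigma X S) f].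
Proof. by rewrite /= negb_exists; apply: eq_forallb => a; rewrite negbK. Qed.

Lemma satb_bigor rho sigma s :
  satb R rho sigma (MBigOr s) = has (satb R rho sigma) s.
Proof.
elim: s => [|f s IH]; first by rewrite /= andbN.
by rewrite [MBigOr _]/= satb_or IH.
Qed.

End Connectives.

(** This makes reachability expressible with a set quantifier. A closed set absorbs every path that
    starts in it, and the set of points reachable from [x] is itself closed. *)
Lemma connect_closedE (T : finType) (r : rel T) (x y : T) :
  connect r x y =
  [forall X : {set T}, (x \in X) &&
     [forall a, forall b, (a \in X) && r a b ==> (b \in X)] ==> (y \in X)].
Proof.
apply/idP/forallP => [/connectP[p rp ->] X|/(_ [set z | connect r x z])].
  apply/implyP => /andP[xX /forallP cl].
  elim: p x rp xX => //= z p IH x /andP[xz rp] xX; apply: IH rp _.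
  by have /forallP/(_ z)/implyP := cl x; rewrite xX xz => /(_ isT).
rewrite !inE connect0 /= => /implyP; apply; apply/forallP => a.
apply/forallP => b; rewrite !inE; apply/implyP => /andP[xa ab].
exact: connect_trans xa (connect1 ab).
Qed.

(** * Orders on edges from orders on vertices *)

(** Every edge has an end incident to it, while nothing is incident to a vertex. *)
Definition MVertex x := MNot (MEx1 x.+1 (MRel x.+1 x)).

(* Interprets a formula about [<V, edg>] in [<V + E, inc>]: set quantifiers may
   pick edges too, but only the vertices of a set are ever tested. *)
Fixpoint to_inc (f : mso) : mso :=
  match f with
  | MRel x y =>
    let z := (x + y).+1 in
    MAnd (MNot (MEq x y)) (MEx1 z (MAnd (MRel x z) (MRel y z)))
  | MNot g => MNot (to_inc g)
  | MAnd g h => MAnd (to_inc g) (to_inc h)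
  | MEx1 x g => MEx1 x (MAnd (MVertex x) (to_inc g))
  | MEx2 X g => MEx2 X (to_inc g)
  | _ => f
  end.

(* The edge [x] precedes the edge [y] if the largest vertex of their symmetric
   difference belongs to [y]. The edges are first copied to the variables 2 and
   3, since [f] must be evaluated on the variables 0 and 1. *)
Definition MEdgeLt f :=
  MEx1 2 (MAnd (MEq 2 0) (MEx1 3 (MAnd (MEq 3 1)
    (MEx1 1 (MAnd (MAnd (MRel 1 3) (MNot (MRel 1 2)))
      (MAll1 0 (MImp (MAnd (MRel 0 2) (MNot (MRel 0 3))) (to_inc f)))))))).

Definition inc_order f :=
  MOr (MAnd (MVertex 0) (MNot (MVertex 1)))
    (MOr (MAnd (MAnd (MVertex 0) (MVertex 1)) (to_inc f))
      (MAnd (MAnd (MNot (MVertex 0)) (MNot (MVertex 1)))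
            (MOr (MEq 0 1) (MEdgeLt f)))).

Lemma fv1_to_inc f : {subset fv1 (to_inc f) <= fv1 f}.
Proof.
elim: f => [x y|x y|x X|g IH|g IHg h IHh|x g IH|X g IH] i; do ?[by []|exact: IH].
- set z := (x + y).+1; have -> : fv1 (to_inc (MRel x y)) =
    [:: x; y] ++ [seq i <- [:: x; z; y; z] | i != z] by [].
  rewrite mem_cat mem_filter !inE => /orP[//|/andP[/negbTE->]].
  by rewrite /= orbF.
- by rewrite /= !mem_cat => /orP[/IHg->|/IHh->]; rewrite ?orbT.
- have -> : fv1 (to_inc (MEx1 x g)) =
    [seq i <- [seq i <- [:: x.+1; x] | i != x.+1] ++ fv1 (to_inc g) | i != x] by [].
  rewrite !(mem_filter, mem_cat) !inE => /andP[nx].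
  by rewrite nx (negbTE nx) orbF andNb /= => /IH.
Qed.

Lemma inc_order_fv f : all (fun i => i <= 1) (fv1 f) ->
  all (fun i => i <= 1) (fv1 (inc_order f)).
Proof.
move=> /allP Hf; have Hi i : i \in fv1 (to_inc f) -> i <= 1 by move/fv1_to_inc/Hf.
apply/allP => -[|[|i]] //.
have /negbTE nf : i.+2 \notin fv1 (to_inc f) by apply/negP => /Hi.
by rewrite /= ?(inE, mem_cat, mem_filter, nf) /= ?(inE, mem_cat, mem_filter, nf, andbF).
Qed.

Section Translation.
Variables (T : finType) (e : rel T).
Hypothesis e_graph : is_graph e.
Local Notation inc := (@inc_rel T e).
Implicit Types (rho : nat -> T) (tau : nat -> inc_univ e).

Definition is_vertex (a : inc_univ e) := if a is inl _ then true else false.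

Lemma satb_vertex tau sigma x :
  satb inc tau sigma (MVertex x) = is_vertex (tau x).
Proof.
rewrite /= /upd /= eqxx (ltn_eqF (ltnSn x)); case: (tau x) => [v|s] /=.
  by apply/existsPn => -[].
apply/negbTE; rewrite negbK; apply/existsP.
case: s => s ie; have /existsP[u /existsP[v /andP[_ /eqP Es]]] := ie.
by exists (inl u); rewrite /= Es !inE eqxx.
Qed.

(** Two distinct members of an edge are its two ends. Without [x != y], every vertex on an edge
    would count as adjacent to itself. *)
Lemma edge_incident x y :
  e x y = (x != y) && [exists z : inc_univ e, inc (inl x) z && inc (inl y) z].
Proof.
have [es ei] := e_graph.
apply/idP/andP => [exy|[nxy /existsP[[//|[s /= ie]]] /andP[]]].
  split; first by apply: contraTneq exy => ->; rewrite ei.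
  have ie : is_edge e [set x; y].
    by apply/existsP; exists x; apply/existsP; exists y; rewrite exy eqxx.
  by apply/existsP; exists (inr (exist (fun s => is_edge e s) _ ie)); rewrite /= !inE !eqxx orbT.
case/existsP: ie => u /existsP[v /andP[euv /eqP->]].
rewrite !inE => /orP[]/eqP Ex /orP[]/eqP Ey; move: nxy; rewrite Ex Ey ?eqxx //.
by rewrite es.
Qed.

(** Agreement is asked on free variables only, because the comparison of edges evaluates [to_inc f]
    while other variables hold edges. In the case of a set quantifier, a set is cut down to its
    vertices, or embedded by [inl]. *)
Lemma satb_to_inc f rho tau (sigma : nat -> {set T}) (sigma' : nat -> {set inc_univ e}) :
  {in fv1 f, forall i, tau i = inl (rho i)} ->
  (forall X v, (inl v \in sigma' X) = (v \in sigma X)) ->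
  satb inc tau sigma' (to_inc f) = satb e rho sigma f.
Proof.
elim: f rho tau sigma sigma' => [x y|x y|x X|g IH|g IHg h IHh|x g IH|X g IH]
  rho tau sigma sigma' Ht Hs.
- rewrite /= edge_incident (Ht x) ?(Ht y) ?inE ?eqxx ?orbT //.
  congr (_ && _); apply: eq_existsb => z; rewrite /upd eqxx.
  rewrite !ltn_eqF ?ltnS ?leq_addr ?leq_addl //.
  by rewrite (Ht x) ?(Ht y) ?inE ?eqxx ?orbT.
- by rewrite /= (Ht x) ?(Ht y) ?inE ?eqxx ?orbT.
- by rewrite /= (Ht x) ?inE ?eqxx.
- by rewrite /= (IH rho _ sigma).
- rewrite /= (IHg rho _ sigma) ?(IHh rho _ sigma) // => i ig;
    by apply: Ht; rewrite /= mem_cat ig ?orbT.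
- rewrite [to_inc _]/= satb_ex1; apply/existsP/existsP => -[a].
    rewrite satb_and satb_vertex {1}/upd eqxx.
    case: a => // v /=; rewrite (IH (upd rho x v) _ sigma) //; first by exists v.
    move=> i ig; rewrite /upd; case: eqP => // /eqP ix.
    by apply: Ht; rewrite /= mem_filter ix.
  move=> Ha; exists (inl a).
  rewrite satb_and satb_vertex {1}/upd eqxx /=.
  rewrite (IH (upd rho x a) _ sigma) //.
  move=> i ig; rewrite /upd; case: eqP => // /eqP ix.
  by apply: Ht; rewrite /= mem_filter ix.
- rewrite /=; apply/existsP/existsP => -[S HS].
    exists [set v | inl v \in S]; rewrite -(IH rho tau _ (upd sigma' X S)) //.
    by move=> Y v; rewrite /upd; case: eqP => _; rewrite ?inE.
  exists [set inl v | v in S]; rewrite (IH rho _ (upd sigma X S)) //.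
  by move=> Y v; rewrite /upd; case: eqP => _; rewrite ?mem_imset //; apply: inl_inj.
Qed.

(** * Comparing edges by their symmetric difference *)

Section EdgeOrder.
Variable le : rel T.
Hypothesis le_linear : linear_order le.
Implicit Types s t u : {set T}.

(** Sets are compared like binary numbers: for linear [le], such a [z] exists exactly when the
    largest element of the symmetric difference lies in [t]. *)
Definition set_lt s t :=
  [exists z, [&& z \in t, z \notin s &
    [forall w, (w \in s) && (w \notin t) ==> le w z]]].

Definition inc_le (a b : inc_univ e) :=
  match a, b with
  | inl v, inl w => le v w
  | inl _, inr _ => true
  | inr _, inl _ => false
  | inr s, inr t => (s == t) || set_lt (val s) (val t)
  end.

Lemma set_ltP s t :
  reflect (exists z, [/\ z \in t, z \notin s &
             forall w, w \in s -> w \notin t -> le w z]) (set_lt s t).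
Proof.
apply: (iffP existsP) => -[z].
  case/and3P=> zt zs /forallP H; exists z; split=> // w ws wt.
  by have := H w; rewrite ws wt.
case=> zt zs H; exists z; rewrite zt zs; apply/forallP => w.
by apply/implyP => /andP[]; apply: H.
Qed.

Lemma set_lt_asym s t : set_lt s t -> ~~ set_lt t s.
Proof.
have [_ anti _ _] := le_linear.
move=> /set_ltP[z [zt zs Hz]]; apply/negP => /set_ltP[y [ys yt Hy]].
by have := zs; rewrite (anti _ _ (Hy _ zt zs) (Hz _ ys yt)) ys.
Qed.

(** The larger of the two witnesses serves for the composite. *)
Lemma set_lt_trans : transitive set_lt.
Proof.
have [_ anti trans total] := le_linear.
move=> t s u /set_ltP[z [zt zs Hz]] /set_ltP[y [yu yt Hy]].
have nzy : z <> y by move=> E; rewrite -E zt in yt.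
apply/set_ltP; case: (total z y) => le_zy.
  exists y; split=> //.
    by apply/negP => ys; apply: nzy; apply: anti le_zy _; apply: Hz.
  move=> w ws wu; case: (boolP (w \in t)) => wt; first exact: Hy.
  by apply: trans le_zy; apply: Hz.
exists z; split=> //.
  by apply/negPn/negP => zu; apply: nzy; apply: anti le_zy; apply: Hy.
move=> w ws wu; case: (boolP (w \in t)) => wt; last exact: Hz.
by apply: trans le_zy; apply: Hy.
Qed.

(** An element of [D] with the most predecessors is the largest: if [z] is below [w], the
    predecessors of [z] are among those of [w], so both sets coincide and [w] is below [z]. *)
Lemma le_max (D : {set T}) z0 : z0 \in D ->
  exists2 z, z \in D & {in D, forall w, le w z}.
Proof.
have [refl _ trans total] := le_linear.
move=> Dz0; case: (arg_maxnP (fun z => #|[set u | le u z]|) Dz0) => z Dz max.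
exists z => // w Dw; case: (total w z) => // zw.
suff /eqP/setP/(_ w) : [set u | le u z] == [set u | le u w].
  by rewrite !inE refl.
rewrite eqEcard [X in _ && X](max _ Dw) andbT; apply/subsetP => u; rewrite !inE => uz.
exact: trans uz zw.
Qed.

Lemma set_lt_total s t : s != t -> set_lt s t || set_lt t s.
Proof.
pose D := (s :\: t) :|: (t :\: s) => nst.
have [z0 Dz0] : exists z, z \in D.
  apply/set0Pn; apply: contraNneq nst => D0; apply/eqP/setP => z.
  by have /setP/(_ z) := D0; rewrite !inE; case: (z \in s); case: (z \in t).
have [z Dz Hz] := le_max Dz0.
move: Dz; rewrite inE => /orP[].
  rewrite inE => /andP[zt zs]; apply/orP; right; apply/set_ltP; exists z; split=> //.
  by move=> w wt ws; apply: Hz; rewrite !inE wt ws orbT.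
rewrite inE => /andP[zs zt]; apply/orP; left; apply/set_ltP; exists z; split=> //.
by move=> w ws wt; apply: Hz; rewrite !inE wt ws.
Qed.

Lemma inc_le_linear : linear_order inc_le.
Proof.
have [refl anti trans total] := le_linear; split.
- by case=> [v|s] /=; rewrite ?eqxx.
- case=> [v|s] [w|t] //=; first by move=> vw wv; rewrite (anti _ _ vw wv).
  case/orP=> [/eqP-> //|st] /orP[/eqP-> //|ts].
  by have := set_lt_asym st; rewrite ts.
- case=> [v|s] [w|t] [x|u] //=; first exact: trans.
  case/orP=> [/eqP-> //|st] /orP[/eqP<-|tu]; first by rewrite st orbT.
  by rewrite (set_lt_trans st tu) orbT.
- case=> [v|s] [w|t] /=; try by [left|right]; first exact: total.
  case: (eqVneq s t) => [_|nst] /=; first by left.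
  by apply/orP; rewrite set_lt_total // (inj_eq val_inj).
Qed.

End EdgeOrder.

Lemma inc_order_defines f : all (fun i => i <= 1) (fv1 f) ->
  defines_order_on e f -> defines_order_on inc (inc_order f).
Proof.
move=> /allP fv [sigma lin].
pose le v w := satb e (env2 v w) sigma f.
have le_linear : linear_order le.
  case: lin => refl anti trans total; split.
  - by move=> a; apply/satP.
  - by move=> a b /satP ab /satP; apply: anti.
  - by move=> a b c /satP ab /satP bc; apply/satP; apply: trans bc.
  - by move=> a b; case: (total a b) => /satP; [left|right].
pose sigma' X : {set inc_univ e} := [set inl v | v in sigma X].
have Hs X v : (inl v \in sigma' X) = (v \in sigma X).
  by rewrite mem_imset //; apply: inl_inj.
have Hle tau v w : tau 0 = inl v -> tau 1 = inl w ->
    satb inc tau sigma' (to_inc f) = le v w.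
  move=> t0 t1; apply: satb_to_inc => // i /fv.
  by case: i => [|[|]].
exists sigma'.
have HE s t : satb inc (env2 (inr s) (inr t)) sigma' (MEdgeLt f) =
    set_lt le (val s) (val t).
  rewrite satb_ex1; apply/existsP/set_ltP => [[x]|[z [zt zs Hz]]].
    rewrite satb_and satb_ex1 => /andP[/eqP Ex /existsP[y]].
    have {}Ex : x = inr s := Ex; subst x.
    rewrite satb_and satb_ex1 => /andP[/eqP Ey /existsP[z]].
    have {}Ey : y = inr t := Ey; subst y.
    rewrite satb_and satb_all1 => /andP[/andP[zt zs] /forallP H].
    case: z => // z in zt zs H *.
    exists z; split=> // w ws wt; have := H (inl w).
    by rewrite satb_imp (Hle _ w z) //= ws wt.
  exists (inr s); rewrite satb_and satb_ex1; apply/andP; split; first exact: eqxx.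
  apply/existsP; exists (inr t).
  rewrite satb_and satb_ex1; apply/andP; split; first exact: eqxx.
  apply/existsP; exists (inl z).
  rewrite satb_and satb_all1; apply/andP; split; first exact/andP.
  apply/forallP => -[w|//].
  by rewrite satb_imp (Hle _ w z) //=; apply/implyP => /andP[]; apply: Hz.
have E a b : satb inc (env2 a b) sigma' (inc_order f) = inc_le le a b.
  rewrite /inc_order satb_or satb_and satb_vertex.
  rewrite satb_or !satb_and !satb_vertex.
  rewrite -[satb _ _ _ (MNot (MVertex 1))]/(~~ satb inc (env2 a b) sigma' (MVertex 1)).
  rewrite -[satb _ _ _ (MNot (MVertex 0))]/(~~ satb inc (env2 a b) sigma' (MVertex 0)).
  rewrite !satb_vertex satb_or.
  case: a b => [v|s] [w|t]; rewrite ?HE ?(Hle _ v w) //=.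
  by rewrite orbF.
have [refl anti trans total] := inc_le_linear le_linear; split.
- by move=> a; apply/satP; rewrite E.
- by move=> a b /satP + /satP; rewrite !E => ab ba; apply: anti.
- by move=> a b c /satP + /satP; rewrite !E => ab bc; apply/satP; rewrite E; apply: trans bc.
- by move=> a b; case: (total a b) => H; [left|right]; apply/satP; rewrite E.
Qed.

End Translation.

Lemma MSO1_orderable_MSO2_orderable (C : graph_class) :
  (forall (T : finType) (e : rel T), C T e -> is_graph e /\ 0 < #|T|) ->
  MSO1_orderable C -> MSO2_orderable C.
Proof.
move=> HC [f [fv Hf]]; exists (inc_order f); split; first exact: inc_order_fv.
move=> T e Ce _; have [eg T0] := HC _ _ Ce.
by apply: inc_order_defines => //; apply: Hf.
Qed.

(** * Types of pieces *)

Fixpoint qrank (f : mso) : nat :=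
  match f with
  | MNot g => qrank g
  | MAnd g h => maxn (qrank g) (qrank h)
  | MEx1 _ g | MEx2 _ g => (qrank g).+1
  | _ => 0
  end.

(** A strict bound on all variables, bound ones included, so that types need to record only finitely
    many variables. *)
Fixpoint vbound (f : mso) : nat :=
  match f with
  | MRel x y | MEq x y | MIn x y => (maxn x y).+1
  | MNot g => vbound g
  | MAnd g h => maxn (vbound g) (vbound h)
  | MEx1 x g | MEx2 x g => maxn x.+1 (vbound g)
  end.

(* Types of a piece: [n] bounds the variables and [K] the size of the core, whose
   elements are seen from the piece only through the adjacency to each of them. *)
Definition atype (n K : nat) : finType :=
  ({set 'I_n} * {set 'I_n * 'I_n} * {set 'I_n * 'I_n} * {set 'I_n * 'I_n} *
   {set 'I_n * 'I_K} * {set 'I_n * 'I_K})%type.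

(** Besides the atomic type, a type of positive rank lists, for each variable, the types of the
    previous rank that arise by reassigning it. This is the back-and-forth system coded as a finite
    type, whose cardinality bounds the number of types. *)
Fixpoint mtype (n K m : nat) : finType :=
  if m is m'.+1 then
    (atype n K * {ffun 'I_n -> {set mtype n K m'}} *
       {ffun 'I_n -> {set mtype n K m'}})%type
  else atype n K.

Section Pieces.
Variables (n K : nat) (A : finType) (R : rel A) (I : finType).
Variables (c : A -> option I) (kx : A -> 'I_K).
Hypothesis kx_inj : {in [pred a | c a == None] &, injective kx}.
Hypothesis R_local : forall x y i j,
  R x y -> c x = Some i -> c y = Some j -> i = j.
Implicit Types (i j : I) (rho : nat -> A) (sigma : nat -> {set A}).

Definition loc i a := c a == Some i.

(** Adjacency to the core is recorded in both directions, as [R] may fail to be symmetric. *)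
Definition atp i rho sigma : atype n K :=
  ([set x : 'I_n | loc i (rho x)],
   [set p : 'I_n * 'I_n | [&& loc i (rho p.1), loc i (rho p.2) &
                              rho p.1 == rho p.2]],
   [set p : 'I_n * 'I_n | [&& loc i (rho p.1), loc i (rho p.2) &
                              R (rho p.1) (rho p.2)]],
   [set p : 'I_n * 'I_n | loc i (rho p.1) && (rho p.1 \in sigma p.2)],
   [set p : 'I_n * 'I_K | loc i (rho p.1) &&
      [exists k, [&& c k == None, kx k == p.2 & R (rho p.1) k]]],
   [set p : 'I_n * 'I_K | loc i (rho p.1) &&
      [exists k, [&& c k == None, kx k == p.2 & R k (rho p.1)]]]).

(* The piece of index [i] consists of the [a] with [c a = Some i], and the core of
   those with [c a = None]. An assignment of the whole structure is used, but its
   values outside the piece are invisible to the type, see [tp_ext]. *)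
Fixpoint tp m i rho sigma : mtype n K m :=
  match m return mtype n K m with
  | 0 => atp i rho sigma
  | m'.+1 =>
    (atp i rho sigma,
     [ffun x : 'I_n => [set tp m' i (upd rho x a) sigma | a : A]],
     [ffun X : 'I_n => [set tp m' i rho (upd sigma X S) | S : {set A}]])
  end.

Definition same_on i rho sigma rho' sigma' :=
  [/\ forall x, x < n -> loc i (rho x) = loc i (rho' x),
      forall x, x < n -> loc i (rho x) -> rho x = rho' x &
      forall X a, X < n -> loc i a -> (a \in sigma X) = (a \in sigma' X)].

Lemma atp_ext i rho sigma rho' sigma' :
  same_on i rho sigma rho' sigma' -> atp i rho sigma = atp i rho' sigma'.
Proof.
case=> Hl He Hs; rewrite /atp.
have He' x : x < n -> loc i (rho' x) -> rho x = rho' x.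
  by move=> xn; rewrite -Hl //; apply: He.
congr (_, _, _, _, _, _); apply/setP => p; rewrite !inE ?Hl //.
- apply: andb_id2l => /He' E1; apply: andb_id2l => /He' E2.
  by rewrite E1 // E2.
- apply: andb_id2l => /He' E1; apply: andb_id2l => /He' E2.
  by rewrite E1 // E2.
- by apply: andb_id2l => l1; rewrite He' // Hs.
- by apply: andb_id2l => l1; rewrite He'.
- by apply: andb_id2l => l1; rewrite He'.
Qed.

Lemma tp_ext m i rho sigma rho' sigma' :
  same_on i rho sigma rho' sigma' -> tp m i rho sigma = tp m i rho' sigma'.
Proof.
elim: m rho sigma rho' sigma' => [|m IH] rho sigma rho' sigma' H.
  exact: atp_ext.
rewrite /= (atp_ext H); case: H => Hl He Hs.
congr (_, _, _); apply/ffunP => x; rewrite !ffunE.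
  by apply: eq_imset => a; apply: IH; split => // y yn;
    rewrite /upd; case: eqP => // _; [exact: Hl | exact: He].
apply: eq_imset => S; apply: IH; split => // Y a Yn la.
by rewrite /upd; case: eqP => // _; apply: Hs.
Qed.

Lemma tpS_inj m i j rho sigma rho' sigma' :
  tp m.+1 i rho sigma = tp m.+1 j rho' sigma' ->
  [/\ atp i rho sigma = atp j rho' sigma',
      forall x, x < n -> [set tp m i (upd rho x a) sigma | a : A] =
                         [set tp m j (upd rho' x a) sigma' | a : A] &
      forall X, X < n ->
        [set tp m i rho (upd sigma X S) | S : {set A}] =
        [set tp m j rho' (upd sigma' X S) | S : {set A}]].
Proof.
pose V := {ffun 'I_n -> {set mtype n K m}}.
move=> /= E; split.
- exact: (congr1 (fun t : atype n K * V * V => t.1.1) E).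
- move=> x xn; have /ffunP/(_ (Ordinal xn)) := congr1 (fun t : atype n K * V * V => t.1.2) E.
  by rewrite !ffunE.
- move=> X Xn; have /ffunP/(_ (Ordinal Xn)) := congr1 (fun t : atype n K * V * V => t.2) E.
  by rewrite !ffunE.
Qed.

Lemma tp_atp m i j rho sigma rho' sigma' :
  tp m i rho sigma = tp m j rho' sigma' ->
  atp i rho sigma = atp j rho' sigma'.
Proof. by case: m => [//|m] /tpS_inj[]. Qed.

Lemma atp_loc i j rho sigma rho' sigma' x : x < n ->
  atp i rho sigma = atp j rho' sigma' -> loc i (rho x) = loc j (rho' x).
Proof. by rewrite /atp => xn [/setP/(_ (Ordinal xn))]; rewrite !inE. Qed.

(** * Exchanging pieces of equal type *)

Section Swap.
Variable pi : I -> I.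
Hypothesis piK : involutive pi.

(** The invariant of an Ehrenfeucht-Fraïssé game with [m] rounds left: pieces correspond along [pi]
    up to type, and the core corresponds to itself by the identity. *)
Definition swapped m rho sigma rho' sigma' :=
  [/\ forall i, tp m i rho sigma = tp m (pi i) rho' sigma',
      forall x, x < n -> c (rho x) = None -> rho x = rho' x,
      forall x, x < n -> c (rho' x) = None -> rho x = rho' x &
      forall X a, X < n -> c a = None -> (a \in sigma X) = (a \in sigma' X)].

Lemma swapped_sym m rho sigma rho' sigma' :
  swapped m rho sigma rho' sigma' -> swapped m rho' sigma' rho sigma.
Proof.
case=> Ht Hx Hx' HX; split.
- by move=> i; rewrite (Ht (pi i)) piK.
- by move=> x xn cx; rewrite Hx'.
- by move=> x xn cx; rewrite Hx.
- by move=> X a Xn ca; rewrite HX.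
Qed.

(** A core element is answered by itself, and an element of piece [i0] by the answer that the
    equality of types yields in piece [pi i0]. *)
Lemma swapped_elem m rho sigma rho' sigma' x a : x < n ->
  swapped m.+1 rho sigma rho' sigma' ->
  exists a', swapped m (upd rho x a) sigma (upd rho' x a') sigma'.
Proof.
move=> xn [Ht Hx Hx' HX].
have Hex i : exists a', tp m i (upd rho x a) sigma =
                        tp m (pi i) (upd rho' x a') sigma'.
  have [_ /(_ _ xn) E _] := tpS_inj (Ht i).
  have : tp m i (upd rho x a) sigma \in [set tp m i (upd rho x a) sigma | a : A].
    exact: imset_f.
  by rewrite E => /imsetP[a' _ ->]; exists a'.
have updl r b i : loc i (upd r x b x) = loc i b by rewrite /upd eqxx.
have [a' [Hn Hn' Hl Htp]] : exists a', [/\ c a = None -> a = a', c a' = None -> a = a',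
    forall i, loc i a = loc (pi i) a' &
    forall i, c a = Some i ->
      tp m i (upd rho x a) sigma = tp m (pi i) (upd rho' x a') sigma'].
  case Ea: (c a) => [i0|].
    have [a' Ha'] := Hex i0; exists a'.
    have := atp_loc xn (tp_atp Ha'); rewrite !updl /loc Ea eqxx => /esym/eqP ca'.
    split; rewrite ?ca' //; last by move=> i [<-].
    by move=> i; rewrite !(inj_eq Some_inj) (inj_eq (inv_inj piK)).
  by exists a; split => // i; rewrite /loc Ea.
exists a'; split => //.
- move=> i; case: (boolP (loc i a)) => [/eqP/Htp //|nla].
  (* For a piece [i] not containing [a], the answer [b] lies outside [pi i]. So does [a'], and the
     type cannot tell them apart. *)
  have [b Hb] := Hex i; rewrite Hb; apply: tp_ext.
  have lb : ~~ loc (pi i) b.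
    by have := atp_loc xn (tp_atp Hb); rewrite !updl => <-.
  have la' : ~~ loc (pi i) a' by rewrite -Hl.
  split => // y yn; rewrite /upd; case: eqP => // _.
    by rewrite (negbTE lb) (negbTE la').
  by rewrite (negbTE lb).
- by move=> y yn; rewrite /upd; case: eqP => // _; apply: Hx.
- by move=> y yn; rewrite /upd; case: eqP => // _; apply: Hx'.
Qed.

(** A set is the union of its traces on the pieces and on the core. The answers for the pieces are
    chosen independently and glued, and the trace on the core is kept. *)
Lemma swapped_set m rho sigma rho' sigma' X S : X < n ->
  swapped m.+1 rho sigma rho' sigma' ->
  exists S', swapped m rho (upd sigma X S) rho' (upd sigma' X S').
Proof.
move=> Xn [Ht Hx Hx' HX].
have Hex i : exists S', tp m i rho (upd sigma X S) =
                        tp m (pi i) rho' (upd sigma' X S').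
  have [_ _ /(_ _ Xn) E] := tpS_inj (Ht i).
  have : tp m i rho (upd sigma X S) \in
         [set tp m i rho (upd sigma X S) | S : {set A}].
    exact: imset_f.
  by rewrite E => /imsetP[a' _ ->]; exists a'.
have [F HF] := fin_all_exists Hex.
exists [set a | if c a is Some j then a \in F (pi j) else a \in S]; split => //.
- move=> i; rewrite HF; apply: tp_ext; split => // Y a Yn /eqP ca.
  by rewrite /upd; case: eqP => // _; rewrite inE ca piK.
- by move=> Y a Yn ca; rewrite /upd; case: eqP => _; rewrite ?inE ?ca // HX.
Qed.

(** For [R], two elements of one piece are settled by its atomic type, elements of distinct pieces
    are unrelated on both sides, and adjacency to the core is read off through [kx]. Each quantifier
    uses up one round. *)
Lemma swapped_satb f m rho sigma rho' sigma' :
  qrank f <= m -> vbound f <= n -> swapped m rho sigma rho' sigma' ->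
  satb R rho sigma f = satb R rho' sigma' f.
Proof.
elim: f m rho sigma rho' sigma' =>
  [x y|x y|x X|g IH|g IHg h IHh|x g IH|X g IH] m rho sigma rho' sigma' /=.
- rewrite gtn_max => _ /andP[xn yn] [Ht Hx Hx' HX].
  have Hlx i : loc i (rho x) = loc (pi i) (rho' x) by apply: atp_loc (tp_atp (Ht i)).
  have Hly i : loc i (rho y) = loc (pi i) (rho' y) by apply: atp_loc (tp_atp (Ht i)).
  case Ex: (c (rho x)) => [i|]; case Ey: (c (rho y)) => [j|].
  + have lx : loc (pi i) (rho' x) by rewrite -Hlx /loc Ex.
    have ly : loc (pi j) (rho' y) by rewrite -Hly /loc Ey.
    have [E|ne] := eqVneq i j.
      subst j.
      have := tp_atp (Ht i); rewrite /atp => -[_ _ /setP/(_ (Ordinal xn, Ordinal yn)) + _ _ _].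
      by rewrite !inE /= lx ly /loc Ex Ey eqxx.
    apply/idP/idP => [/R_local/(_ Ex Ey) E|/R_local]; first by rewrite E eqxx in ne.
    move=> /(_ _ _ (eqP lx) (eqP ly)) /(inv_inj piK) E.
    by rewrite E eqxx in ne.
  + have lx : loc (pi i) (rho' x) by rewrite -Hlx /loc Ex.
    have := tp_atp (Ht i); rewrite /atp => -[_ _ _ _ /setP/(_ (Ordinal xn, kx (rho y))) + _].
    rewrite !inE /= lx /loc Ex eqxx /= -(Hx _ yn Ey).
    have core u : [exists k, [&& c k == None, kx k == kx (rho y) & R u k]] = R u (rho y).
      apply/existsP/idP => [[k /and3P[ck /eqP/kx_inj <-]]|Ruy]; rewrite ?inE ?Ey //.
      by exists (rho y); rewrite Ey !eqxx.
    by rewrite !core.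
  + have ly : loc (pi j) (rho' y) by rewrite -Hly /loc Ey.
    have := tp_atp (Ht j); rewrite /atp => -[_ _ _ _ _ /setP/(_ (Ordinal yn, kx (rho x)))].
    rewrite !inE /= ly /loc Ey eqxx /= -(Hx _ xn Ex).
    have core u : [exists k, [&& c k == None, kx k == kx (rho x) & R k u]] = R (rho x) u.
      apply/existsP/idP => [[k /and3P[ck /eqP/kx_inj <-]]|Ruy]; rewrite ?inE ?Ex //.
      by exists (rho x); rewrite Ex !eqxx.
    by rewrite !core.
  + by rewrite -!Hx.
- rewrite gtn_max => _ /andP[xn yn] [Ht Hx Hx' HX].
  have Hlx i : loc i (rho x) = loc (pi i) (rho' x) by apply: atp_loc (tp_atp (Ht i)).
  have Hly i : loc i (rho y) = loc (pi i) (rho' y) by apply: atp_loc (tp_atp (Ht i)).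
  case Ex: (c (rho x)) => [i|].
    have lx : loc (pi i) (rho' x) by rewrite -Hlx /loc Ex.
    have := tp_atp (Ht i); rewrite /atp => -[_ /setP/(_ (Ordinal xn, Ordinal yn)) + _ _ _ _].
    rewrite !inE /= lx -Hly /loc Ex eqxx /=.
    have [//|ne _] := eqVneq (c (rho y)) (Some i).
    apply/eqP/eqP => E; first by rewrite -E Ex eqxx in ne.
    by move: ne; rewrite -/(loc i _) Hly -E lx.
  case Ey: (c (rho y)) => [j|]; last by rewrite -!Hx.
  have ly : loc (pi j) (rho' y) by rewrite -Hly /loc Ey.
  apply/eqP/eqP => E; first by rewrite E Ey in Ex.
  by move: ly; rewrite -E -Hlx /loc Ex.
- rewrite gtn_max => _ /andP[xn Xn] [Ht Hx Hx' HX].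
  case Ex: (c (rho x)) => [i|]; last by rewrite -Hx // HX.
  have := tp_atp (Ht i); rewrite /atp => -[_ _ _ /setP/(_ (Ordinal xn, Ordinal Xn)) + _ _].
  by rewrite !inE /= -(atp_loc xn (tp_atp (Ht i))) /loc Ex eqxx.
- by move=> qm vn H; rewrite (IH _ _ _ _ _ qm vn H).
- rewrite !geq_max => /andP[qg qh] /andP[vg vh] H.
  by rewrite (IHg _ _ _ _ _ qg vg H) (IHh _ _ _ _ _ qh vh H).
- case: m => // m qm; rewrite geq_max => /andP[xn vn] H.
  apply/existsP/existsP => -[a Ha].
    have [a' H'] := swapped_elem a xn H; exists a'.
    by rewrite -(IH _ _ _ _ _ qm vn H').
  have [a' H'] := swapped_elem a xn (swapped_sym H); exists a'.
  by rewrite (IH _ _ _ _ _ qm vn (swapped_sym H')).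
- case: m => // m qm; rewrite geq_max => /andP[xn vn] H.
  apply/existsP/existsP => -[a Ha].
    have [a' H'] := swapped_set a xn H; exists a'.
    by rewrite -(IH _ _ _ _ _ qm vn H').
  have [a' H'] := swapped_set a xn (swapped_sym H); exists a'.
  by rewrite (IH _ _ _ _ _ qm vn (swapped_sym H')).
Qed.

End Swap.

(** By pigeonhole, two pieces agree on the types of both ordered pairs formed by their marked
    element and an outside one, whence the square. Exchanging them makes [f] symmetric on their
    marked elements, against totality and antisymmetry. *)
Lemma order_few_pieces f (J : {set I}) (a : I -> A) :
  vbound f <= n -> {in J, forall i, c (a i) = Some i} ->
  defines_order_on R f -> #|J| <= (#|mtype n K (qrank f)| ^ 2).+1.
Proof.
move=> vn ca [sigma [_ anti _ total]]; rewrite leqNgt; apply/negP => big.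
set m := qrank f in big.
have /card_gt1P[i1 [i2 [Ji1 Ji2 ne12]]] : 1 < #|J| by apply: leq_ltn_trans big.
(* [o i] stands for any marked element outside piece [i], since outside elements look alike from
   there. The successor in the bound ensures that two pieces exist. *)
pose o i := if i == i1 then a i2 else a i1.
have co i : i \in J -> ~~ loc i (o i).
  rewrite /o /loc; case: (eqVneq i i1) => [->|ni] _; rewrite ca //.
    by rewrite (inj_eq Some_inj) eq_sym.
  by rewrite (inj_eq Some_inj) eq_sym.
pose F i := (tp m i (env2 (a i) (o i)) sigma, tp m i (env2 (o i) (a i)) sigma).
have : ~~ dinjectiveb F (mem J).
  apply/negP => /dinjectiveP/card_in_imset E.
  move: big; rewrite -E ltnNge => /negP; apply; apply: leqW.
  by apply: leq_trans (max_card _) _; rewrite card_prod.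
case/dinjectivePn => i Ji [j /andP[nji Jj] [Eij Eji]].
have nij : i != j by rewrite eq_sym.
have lai k : k \in J -> loc k (a k) by move=> Jk; rewrite /loc ca.
have laij k l : k \in J -> l \in J -> k != l -> ~~ loc k (a l).
  by move=> Jk Jl; rewrite /loc ca // (inj_eq Some_inj) eq_sym.
have tp1 k l : k \in J -> l \in J -> k != l ->
    tp m k (env2 (a k) (a l)) sigma = tp m k (env2 (a k) (o k)) sigma.
  move=> Jk Jl nkl; apply: tp_ext; split=> // x _; rewrite /env2; case: eqP => // _;
    by rewrite (negbTE (laij _ _ Jk Jl nkl)) // (negbTE (co _ Jk)).
have tp2 k l : k \in J -> l \in J -> k != l ->
    tp m k (env2 (a l) (a k)) sigma = tp m k (env2 (o k) (a k)) sigma.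
  move=> Jk Jl nkl; apply: tp_ext; split=> // x _; rewrite /env2; case: eqP => // _;
    by rewrite (negbTE (laij _ _ Jk Jl nkl)) // (negbTE (co _ Jk)).
pose pi k := if k == i then j else if k == j then i else k.
have piK : involutive pi.
  move=> k; rewrite /pi; case: (eqVneq k i) => [->|ki].
    by rewrite eqxx; case: eqP.
  case: (eqVneq k j) => [->|kj]; first by rewrite eqxx.
  by rewrite (negbTE ki) (negbTE kj).
have sw : swapped pi m (env2 (a i) (a j)) sigma (env2 (a j) (a i)) sigma.
  split=> //; try by move=> x _; rewrite /env2; case: eqP => _; rewrite ca.
  move=> k; rewrite /pi; case: (eqVneq k i) => [->|ki]; first by rewrite !tp1.
  case: (eqVneq k j) => [->|kj]; first by rewrite !tp2.
  apply: tp_ext; split => // x _; rewrite /env2 /loc; case: (x == 0);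
   by rewrite !ca // !(inj_eq Some_inj) ?[i == k]eq_sym ?[j == k]eq_sym
              ?(negbTE ki) ?(negbTE kj).
have E := swapped_satb piK (leqnn _) vn sw.
have both : satb R (env2 (a i) (a j)) sigma f && satb R (env2 (a j) (a i)) sigma f.
  by case: (total (a i) (a j)) => /satP H; move: E; rewrite H; [move=> <-|move=> ->].
case/andP: both => /satP H1 /satP H2.
by have := lai _ Ji; rewrite (anti _ _ H1 H2) (negbTE (laij _ _ Ji Jj nij)).
Qed.

End Pieces.

(** * Components after deleting a set of vertices *)

Lemma del_rel_sym (T : finType) (e : rel T) (S : {set T}) :
  symmetric e -> connect_sym (del_rel e S).
Proof.
move=> es; apply: sym_connect_sym => x y; rewrite /del_rel es.
by case: (x \in S); case: (y \in S).
Qed.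

Section IncidencePieces.
Variables (T : finType) (e : rel T) (S : {set T}).
Hypothesis e_graph : is_graph e.

(** A component is named by its root. An edge joins the component of an end outside [S], and both
    ends agree if both are outside; edges inside [S] go to the core. *)
Definition comp_of (a : inc_univ e) : option T :=
  match a with
  | inl v => if v \in S then None else Some (root (del_rel e S) v)
  | inr s => if [pick v in val s :\: S] is Some v
             then Some (root (del_rel e S) v) else None
  end.

Lemma edge_connect (s : edge_type e) v w :
  v \in val s -> w \in val s -> v \notin S -> w \notin S ->
  connect (del_rel e S) v w.
Proof.
have [es _] := e_graph.
case: s => s /= /existsP[x /existsP[y /andP[exy /eqP->]]].
rewrite !inE => /orP[]/eqP-> /orP[]/eqP-> nx ny; do ?exact: connect0;
  by apply: connect1; rewrite /del_rel nx ny // es.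
Qed.

Lemma comp_of_local (a b : inc_univ e) i j :
  inc_rel a b -> comp_of a = Some i -> comp_of b = Some j -> i = j.
Proof.
case: a b => [v|s] [w|t] //= vt.
case: ifP => // /negbT nv [<-]; case: pickP => // w; rewrite inE => /andP[nw wt] [<-].
apply/(rootP (del_rel_sym _ _)); first by case: e_graph.
exact: edge_connect vt wt nv nw.
Qed.

(** An edge in the core is a subset of [S], which leaves at most [2 ^ #|S|] of them. *)
Lemma card_core : #|[pred a | comp_of a == None]| <= #|S| + 2 ^ #|S|.
Proof.
pose F : {set inc_univ e} := [set inl v | v in S].
pose G : {set inc_univ e} := [set inr s | s in [set s : edge_type e | val s \subset S]].
apply: (@leq_trans #|F :|: G|).
  apply: subset_leq_card; apply/subsetP => -[v|s]; rewrite !inE /=.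
    by case: ifP => // vS _; rewrite imset_f.
  case: pickP => // H _; rewrite [X in _ || X]imset_f ?orbT // inE.
  apply/subsetP => v vs; have := H v; rewrite inE vs andbT; exact: negbFE.
apply: leq_trans (leq_card_setU _ _) _; apply: leq_add.
  exact: leq_imset_card.
apply: leq_trans (leq_imset_card _ _) _.
rewrite -card_powerset -(card_imset _ val_inj); apply: subset_leq_card.
by apply/subsetP => X /imsetP[s]; rewrite !inE => sS ->.
Qed.

Lemma MSO2_order_few_components f :
  defines_order_on (@inc_rel T e) f ->
  ncomp_del e S <=
    (#|mtype (vbound f) (#|S| + 2 ^ #|S|).+1 (qrank f)| ^ 2).+1.
Proof.
move=> df; set K := #|S| + _.
(* Core elements are numbered by their position in an enumeration; the successor keeps the range
   inhabited even if the core is empty. *)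
pose kx (a : inc_univ e) : 'I_K.+1 := inord (index a (enum [pred a | comp_of a == None])).
have kx_inj : {in [pred a | comp_of a == None] &, injective kx}.
  have small a : a \in [pred a | comp_of a == None] ->
      index a (enum [pred a | comp_of a == None]) < K.+1.
    move=> ca; apply: leq_trans (leqW card_core).
    by rewrite cardE index_mem mem_enum.
  move=> a b ca cb /(congr1 val); rewrite /= !inordK ?small //.
  by apply: index_inj; rewrite ?mem_enum.
pose J := [set r | roots (del_rel e S) r & r \notin S].
have -> : ncomp_del e S = #|J|.
  by rewrite cardsE; apply: eq_card => r; rewrite !inE.
(* The marked element of each component is its root, seen as a vertex. *)
apply: (order_few_pieces kx_inj comp_of_local (a := inl)) df => //.
by move=> r; rewrite inE /= => /andP[/eqP-> /negbTE->].
Qed.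

End IncidencePieces.

Lemma MSO2_orderable_SEP (C : graph_class) :
  (forall (T : finType) (e : rel T), C T e -> is_graph e /\ 0 < #|T|) ->
  MSO2_orderable C -> has_SEP C.
Proof.
move=> HC [f [_ Hf]].
pose F k := (#|mtype (vbound f) (k + 2 ^ k).+1 (qrank f)| ^ 2).+1.
(* The maximum covers the sets [S] with fewer than [k] elements. *)
exists (fun k => \max_(i < k.+1) F i) => T e Ce k.
have [eg T0] := HC _ _ Ce.
apply/bigmax_leqP => S Sk.
have Ho : defines_order_on (@inc_rel T e) f.
  by apply: Hf Ce _; rewrite card_sum ltn_addr.
apply: leq_trans (MSO2_order_few_components S eg Ho) _.
exact: (@leq_bigmax _ (fun i : 'I_k.+1 => F i) (Ordinal (Sk : #|S| < k.+1))).
Qed.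

Lemma SEP_bounded_degree (C : graph_class) :
  (forall (T : finType) (e : rel T), C T e -> is_tree e) ->
  has_SEP C -> bounded_degree C.
Proof.
move=> HC [f Hf]; exists (f 1) => T e Ce.
have [[es ei] _ _ acyc] := HC _ _ Ce.
apply/bigmax_leqP => v _; apply: leq_trans (Hf _ _ Ce 1).
apply: (@leq_trans (ncomp_del e [set v])); last first.
  by apply: (@leq_bigmax_cond _ _ (ncomp_del e)); rewrite cards1.
set d := del_rel e [set v]; have ds : connect_sym d by apply: del_rel_sym.
(* Neighbours of [v] lie in distinct components: a path between two of them avoiding [v] would close
   up through [v] to a cycle of length at least 3. *)
have rinj : {in [set u | e v u] &, injective (root d)}.
  move=> u w; rewrite !inE => evu + /eqP; rewrite (root_connect ds).
  move=> + /connectP[p0 dp0 Ew]; rewrite {w}Ew.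
  case/shortenP: dp0 => p dp up _ evw.
  have vp : v \notin u :: p.
    rewrite inE negb_or; apply/andP; split; first by apply: contraTneq evu => <-; rewrite ei.
    elim: p u dp {evu evw up} => //= w p IH u /andP[/and3P[_ vw _] dp].
    by rewrite inE eq_sym -in_set1 (negbTE vw) (IH _ dp).
  have ep : path e u p by apply: sub_path dp => a b /and3P[].
  case: p => // w p in up vp dp ep evw *.
  suff /acyc : ucycle e (v :: u :: w :: p) by [].
  rewrite /ucycle /ucycleb cons_uniq vp up !andbT.
  by rewrite (cycle_path v) /= -/(path e u (w :: p)) ep andbT /= es evu andbT.
rewrite /degree -(card_in_imset rinj) ; apply: subset_leq_card.
apply/subsetP => r /imsetP[u]; rewrite inE => evu ->; rewrite !inE.
have nv : u != v by apply: contraTneq evu => ->; rewrite ei.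
rewrite roots_root //=.
(* The root of [u] differs from [v]: it is [u] itself or the end of a step that avoids [v]. *)
have /connectP[p + ->] := connect_root d u.
case/lastP: p => //= p w; rewrite rcons_path last_rcons => /andP[_ /and3P[_]].
by rewrite inE.
Qed.

(** * Ordering trees of bounded degree *)

Fixpoint lexb (s t : seq nat) : bool :=
  match s, t with
  | [::], _ => true
  | _ :: _, [::] => false
  | a :: s', b :: t' => (a < b) || (a == b) && lexb s' t'
  end.

Lemma lexb_linear : linear_order lexb.
Proof.
split.
- by elim=> //= a s ->; rewrite eqxx orbT.
- elim=> [|a s IH] [|b t] //= /orP[ab|/andP[/eqP<- st]] /orP[ba|/andP[/eqP ba ts]].
  + by move: (ltn_trans ab ba); rewrite ltnn.
  + by move: ab; rewrite ba ltnn.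
  + by move: ba; rewrite ltnn.
  + by rewrite (IH t).
- elim=> [|a s IH] [|b t] [|c u] //= /orP[ab|/andP[/eqP<- st]] /orP[bc|/andP[/eqP<- tu]].
  + by rewrite (ltn_trans ab bc).
  + by rewrite ab.
  + by rewrite bc.
  + by rewrite eqxx (IH t) ?orbT.
- elim=> [|a s IH] [|b t] /=; try by [left|right].
  by case: ltngtP => _ /=; [left|right|apply: IH].
Qed.

(** Phrased through prefixes only, as these will be the ancestors in the tree. *)
Lemma lexbP s t : reflect
  (prefix s t \/ exists w i j, [/\ i < j, prefix (rcons w i) s & prefix (rcons w j) t])
  (lexb s t).
Proof.
elim: s t => [|a s IH] [|b t] /=; try by [constructor; left | constructor; case=> [//|[[|? ?] [? [? []]]]]].
apply: (iffP orP) => [[ab|/andP[/eqP<- /IH[p|[w [i [j [ij wi wj]]]]]]]|].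
- by right; exists [::], a, b; split=> //=; rewrite eqxx prefix0s.
- by left; rewrite eqxx.
- by right; exists (a :: w), i, j; split=> //=; rewrite eqxx.
- case=> [/andP[/eqP-> p]|[[|c w] [i [j [ij]]]]] /=.
  + by right; rewrite eqxx; apply/IH; left.
  + by move=> /andP[/eqP<- _] /andP[/eqP<- _]; left.
  + move=> /andP[/eqP<- wi] /andP[/eqP<- wj]; right; rewrite eqxx; apply/IH.
    by right; exists w, i, j.
Qed.

Lemma prefix_rconsE (s t : seq nat) a :
  prefix s (rcons t a) = (s == rcons t a) || prefix s t.
Proof.
apply/idP/orP => [|[/eqP->|]]; last first.
- by move=> st; apply: prefix_trans st (prefix_rcons _ _).
- exact: prefix_refl.
case/prefixP => u; case/lastP: u => [|u b]; first by rewrite cats0 => ->; left.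
rewrite -rcons_cat => /rcons_inj[-> _]; right; exact: prefix_prefix.
Qed.

(** * Addresses in a rooted tree with coloured children *)

Section RootedTree.
Variables (T : finType) (r : T) (dep col : T -> nat) (p : T -> T).
Hypothesis dep0 : forall x, dep x = 0 -> x = r.
Hypothesis depS : forall x, 0 < dep x -> dep x = (dep (p x)).+1.
Hypothesis col_inj : forall x y, 0 < dep x -> 0 < dep y -> p x = p y ->
  col x = col y -> x = y.

Definition parent : rel T := fun x y => (0 < dep x) && (p x == y).

(** The colours on the path from the root down to [x]; the depth serves as fuel for the
    recursion. *)
Fixpoint address_n n x := if n is n'.+1 then rcons (address_n n' (p x)) (col x) else [::].
Definition address x := address_n (dep x) x.

Lemma addressS x : 0 < dep x -> address x = rcons (address (p x)) (col x).
Proof. by move=> d; rewrite /address (depS d). Qed.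

Lemma address0 x : dep x = 0 -> address x = [::].
Proof. by rewrite /address => ->. Qed.

Lemma size_address x : size (address x) = dep x.
Proof.
have H n y : size (address_n n y) = n.
  by elim: n y => //= n IH y; rewrite size_rcons IH.
exact: H.
Qed.

Lemma address_inj : injective address.
Proof.
move=> x; have [n] := ubnP (dep x); elim: n x => // n IH x dn y E.
have Ed : dep x = dep y by rewrite -!size_address E.
case: (posnP (dep x)) => [d0|dx]; first by rewrite (dep0 d0) (dep0 (esym (etrans (esym d0) Ed))).
have dy : 0 < dep y by rewrite -Ed.
move: E; rewrite (addressS dx) (addressS dy) => /rcons_inj[Ep Ec].
by apply: col_inj => //; apply: IH Ep; rewrite -ltnS -depS.
Qed.

Lemma prefix_address x s : prefix s (address x) ->
  exists2 u, connect parent x u & address u = s.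
Proof.
have [n] := ubnP (dep x); elim: n x => // n IH x dn.
case: (posnP (dep x)) => [d0|dx].
  by rewrite address0 // prefixs0 => /eqP->; exists x; rewrite ?address0.
rewrite addressS // prefix_rconsE -addressS // => /orP[/eqP->|]; first by exists x.
case/IH=> [|u cu <-]; first by rewrite -ltnS -depS.
by exists u => //; apply: connect_trans cu; apply: connect1; rewrite /parent dx eqxx.
Qed.

Lemma connect_parent x u : connect parent x u = prefix (address u) (address x).
Proof.
apply/idP/idP => [/connectP[q + ->]|/prefix_address[v cv /address_inj <- //]].
elim: q x => [|y q IH] x /=; first by rewrite prefix_refl.
case/andP=> /andP[dx /eqP Ep] /IH pq; apply: prefix_trans pq _.
by rewrite (addressS dx) Ep prefix_rcons.
Qed.

(** Where two addresses branch, the next vertices [u] and [v] on the two paths are siblings. The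
    right-hand side uses only ancestry, parenthood and colours, all definable. *)
Lemma lex_addressE x y : lexb (address x) (address y) =
  connect parent y x ||
  [exists u, exists v, [&& connect parent x u, connect parent y v,
     [exists w, parent u w && parent v w] & col u < col v]].
Proof.
apply/lexbP/orP; rewrite connect_parent => -[H|H]; try by left.
- right; case: H => w [i [j [ij /prefix_address[u xu Eu] /prefix_address[v yv Ev]]]].
  have du : 0 < dep u by rewrite -size_address Eu size_rcons.
  have dv : 0 < dep v by rewrite -size_address Ev size_rcons.
  move: Eu Ev; rewrite (addressS du) (addressS dv) => /rcons_inj[Eu Ei] /rcons_inj[Ev Ej].
  apply/existsP; exists u; apply/existsP; exists v; rewrite xu yv Ei Ej ij andbT /=.
  apply/existsP; exists (p u); rewrite /parent du dv eqxx /=.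
  by apply/eqP/address_inj; rewrite Eu.
- right; case/existsP: H => u /existsP[v /and4P[xu yv /existsP[w]]].
  case/andP=> /andP[du /eqP uw] /andP[dv /eqP vw] uv.
  exists (address w), (col u), (col v); split=> //.
    by rewrite -uw -addressS // -connect_parent.
  by rewrite -vw -addressS // -connect_parent.
Qed.

End RootedTree.

(* Set variable 0 is bound; 1, 2, 3 hold the vertices of depth 0, 1, 2 modulo 3,
   and 4 + i holds the vertices of colour i. *)
Definition MParent x y :=
  MAnd (MRel x y)
    (MOr (MAnd (MIn x 2) (MIn y 1))
      (MOr (MAnd (MIn x 3) (MIn y 2)) (MAnd (MIn x 1) (MIn y 3)))).

Definition MAncestor x u :=
  MAll2 0 (MImp (MAnd (MIn x 0)
      (MAll1 4 (MAll1 5 (MImp (MAnd (MIn 4 0) (MParent 4 5)) (MIn 5 0)))))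
    (MIn u 0)).

Definition MColourLt d x y :=
  MBigOr [seq MAnd (MIn x (4 + q.1)) (MIn y (4 + q.2)) |
          q <- [seq (i, j) | i <- iota 0 d, j <- iota 0 d] & q.1 < q.2].

Definition tree_order d :=
  MOr (MAncestor 1 0)
    (MEx1 2 (MEx1 3 (MAnd (MAncestor 0 2) (MAnd (MAncestor 1 3)
      (MAnd (MEx1 6 (MAnd (MParent 2 6) (MParent 3 6))) (MColourLt d 2 3)))))).

Lemma tree_order_fv d : all (fun i => i <= 1) (fv1 (tree_order d)).
Proof.
rewrite /=.
apply/allP => i; rewrite !mem_filter.
rewrite /MColourLt; elim: [seq _ <- _ | _] => [|q s IH] /=; first by rewrite !inE !orbb => /and3P[_ _ /eqP->].
by rewrite !inE => /and3P[n2 n3]; rewrite (negbTE n2) (negbTE n3) /= => H; apply: IH; rewrite n2 n3.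
Qed.

Section TreeOrder.
Variables (T : finType) (e : rel T) (r : T) (dep col : T -> nat) (p : T -> T).
Variable d : nat.
Hypothesis dep0 : forall x, dep x = 0 -> x = r.
Hypothesis depS : forall x, 0 < dep x -> dep x = (dep (p x)).+1.
Hypothesis e_par : forall x, 0 < dep x -> e x (p x).
Hypothesis eP : forall x y, e x y -> parent dep p x y || parent dep p y x.
Hypothesis col_inj : forall x y, 0 < dep x -> 0 < dep y -> p x = p y ->
  col x = col y -> x = y.
Hypothesis col_lt : forall x, 0 < dep x -> col x < d.

Definition tree_sets (k : nat) : {set T} :=
  [set x | if k < 4 then dep x %% 3 == k.-1 else col x == k - 4].

(** Index 0 is exempt because [MAncestor] quantifies over that set variable. *)
Definition params (sigma : nat -> {set T}) :=
  forall k, 0 < k -> sigma k = tree_sets k.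

(** The depths of the ends of an edge differ by exactly one, and residues modulo 3 tell which end is
    deeper. *)
Lemma satb_parent rho sigma x y : params sigma ->
  satb e rho sigma (MParent x y) = parent dep p (rho x) (rho y).
Proof.
move=> Hs; rewrite /MParent [LHS]/= -/(satb _ _ _ _) !negb_and !negbK !Hs // !inE /=.
have modS n : n.+1 %% 3 = if n %% 3 == 2 then 0 else (n %% 3).+1.
  rewrite -addn1 -modnDml; have : n %% 3 < 3 by rewrite ltn_mod.
  by case: (n %% 3) => [|[|[|]]].
have par3 a b : parent dep p a b -> dep a = (dep b).+1.
  by case/andP=> /depS-> /eqP->.
have m3 n : n %% 3 < 3 by rewrite ltn_mod.
apply/andP/idP => [[/eP/orP[//|/par3->]]|/[dup] /par3 ->].
  rewrite modS; case: (dep (rho x) %% 3) (m3 (dep (rho x))) => [|[|[|]]] //.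
move=> /andP[dx /eqP <-]; split; first exact: e_par.
by rewrite modS; case: (dep _ %% 3) (m3 (dep (p (rho x)))) => [|[|[|]]].
Qed.

Lemma satb_ancestor rho sigma x u : params sigma ->
  satb e rho sigma (MAncestor x u) = connect (parent dep p) (rho x) (rho u).
Proof.
move=> Hs; rewrite satb_all2 connect_closedE; apply: eq_forallb => X.
have Hs' : params (upd sigma 0 X) by case=> // k _; apply: Hs.
rewrite satb_imp satb_and; congr (_ && _ ==> _).
rewrite satb_all1; apply: eq_forallb => a.
rewrite satb_all1; apply: eq_forallb => b.
by rewrite satb_imp satb_and satb_parent.
Qed.

Lemma satb_colour_lt rho sigma x y : params sigma ->
  0 < dep (rho x) -> 0 < dep (rho y) ->
  satb e rho sigma (MColourLt d x y) = (col (rho x) < col (rho y)).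
Proof.
move=> Hs dx dy; rewrite satb_bigor has_map; apply/hasP/idP.
  case=> -[i j]; rewrite mem_filter /= => /andP[ij _].
  by rewrite !Hs // !inE /= !addKn => /andP[/eqP-> /eqP->].
move=> xy; exists (col (rho x), col (rho y)).
  by rewrite mem_filter xy /=; apply/allpairsP; exists (col (rho x), col (rho y));
     rewrite !mem_iota !col_lt.
by rewrite /= !Hs // !inE /= !addKn !eqxx.
Qed.

Lemma tree_order_defines : defines_order_on e (tree_order d).
Proof.
exists tree_sets; have Hs : params tree_sets by [].
have E a b : satb e (env2 a b) tree_sets (tree_order d) =
             lexb (address dep col p a) (address dep col p b).
  rewrite (lex_addressE dep0 depS col_inj) satb_or satb_ancestor //; congr (_ || _).
  rewrite satb_ex1; apply: eq_existsb => u.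
  rewrite satb_ex1; apply: eq_existsb => v.
  rewrite !satb_and !satb_ancestor //; congr [&& _, _ & _].
  rewrite satb_ex1; under eq_existsb => w do rewrite satb_and !satb_parent //.
  (* Colours are bounded by [d] only at positive depth, which the common parent guarantees for [u]
     and [v]. *)
  apply: andb_id2l => /existsP[w /andP[/andP[du _] /andP[dv _]]].
  by rewrite satb_colour_lt.
have [lr la lt ltot] := lexb_linear.
split.
- by move=> a; apply/satP; rewrite E.
- move=> a b /satP + /satP; rewrite !E => ab ba.
  by apply: (address_inj dep0 depS col_inj); apply: la.
- by move=> a b c /satP + /satP; rewrite !E => ab bc; apply/satP; rewrite E; apply: lt bc.
- by move=> a b; case: (ltot (address dep col p a) (address dep col p b)) => H;
    [left|right]; apply/satP; rewrite E.
Qed.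

End TreeOrder.

(** [dep] is the distance to [r], and [p x] is a neighbour of [x] closer to [r] by one. *)
Lemma tree_rooting (T : finType) (e : rel T) (r : T) : is_tree e ->
  exists (dep : T -> nat) (p : T -> T),
    [/\ forall x, dep x = 0 -> x = r,
        forall x, 0 < dep x -> dep x = (dep (p x)).+1,
        forall x, 0 < dep x -> e x (p x) &
        forall x y, e x y -> parent dep p x y || parent dep p y x].
Proof.
case=> [[es ei] _ conn acyc].
pose P x n := [exists t : n.-tuple T, path e x t && (last x t == r)].
have exP x : exists n, P x n.
  have /connectP[q eq Er] := conn x r; exists (size q); apply/existsP.
  by exists (in_tuple q); rewrite /= eq -Er eqxx.
pose dep x := ex_minn (exP x).
have depP x : P x (dep x) by rewrite /dep; case: ex_minnP.
have dep_le x n : P x n -> dep x <= n by rewrite /dep; case: ex_minnP => m _ H /H.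
have nxt x : 0 < dep x -> exists y, e x y && (dep x == (dep y).+1).
  move=> dx; have /existsP[t /andP[et /eqP lt]] := depP x.
  case: t et lt => -[|y q] /= /eqP sq; first by rewrite -sq in dx.
  case/andP=> exy eq lt; exists y; rewrite exy /= eqn_leq; apply/andP; split.
    apply: dep_le; have /existsP[t /andP[et lt']] := depP y.
    by apply/existsP; exists (cons_tuple y t); rewrite /= exy et.
  rewrite -sq ltnS; apply: dep_le; apply/existsP; exists (in_tuple q).
  by rewrite /= eq lt eqxx.
(* The default [x] is taken only at the root. *)
pose p x := odflt x [pick y | e x y && (dep x == (dep y).+1)].
have pP x : 0 < dep x -> e x (p x) && (dep x == (dep (p x)).+1).
  by move/nxt => [y Hy]; rewrite /p; case: pickP => //= /(_ y); rewrite Hy.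
have dep0 x : dep x = 0 -> x = r.
  by move=> d0; have := depP x; rewrite d0 => /existsP[t]; rewrite tuple0 => /eqP.
have depS x : 0 < dep x -> dep x = (dep (p x)).+1 by move=> /pP/andP[_ /eqP].
exists dep, p; split=> //; first by move=> x /pP/andP[].
(* The parent edges span the tree, so a further edge would close a cycle. *)
move=> x y exy; pose e' : rel T := fun x y => parent dep p x y || parent dep p y x.
have e's : connect_sym e' by apply: sym_connect_sym => a b; rewrite /e' orbC.
have e'e a b : e' a b -> e a b.
  by case/orP=> /andP[/pP/andP[+ _] /eqP<-] //; rewrite es.
have tor a : connect e' a r.
  have [n] := ubnP (dep a); elim: n a => // n IH a dn.
  case: (posnP (dep a)) => [/dep0->|da]; first exact: connect0.
  apply: connect_trans (IH (p a) _); last by rewrite -ltnS -depS.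
  by apply: connect1; rewrite /e' /parent da eqxx.
have /connectP[q0 pq0 Ey] : connect e' x y.
  by apply: connect_trans (tor x) _; rewrite e's.
move: exy; rewrite {y}Ey; case/shortenP: pq0 => q eq uq _ exy.
have eeq : path e x q by apply: sub_path eq => a b /e'e.
have /acyc : ucycle e (x :: q).
  by rewrite /ucycle /ucycleb uq andbT /= rcons_path eeq es.
(* Acyclicity leaves at most one vertex in [q]: none would give a loop, and a single one is joined
   to [x] by a parent edge. *)
case: q eq {uq eeq} exy => [|z [|]] //=; first by rewrite ei.
by rewrite andbT.
Qed.

Lemma bounded_degree_MSO1_orderable (C : graph_class) :
  (forall (T : finType) (e : rel T), C T e -> is_tree e) ->
  bounded_degree C -> MSO1_orderable C.
Proof.
move=> HC [d Hd]; exists (tree_order d); split; first exact: tree_order_fv.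
move=> T e Ce /card_gt0P[r _]; have tree := HC _ _ Ce.
have [[es _] _ _ _] := tree.
have [dep [p [dep0 depS e_par eP]]] := tree_rooting r tree.
(* The colour of [x] is its position among its siblings, which are all neighbours of [p x]; hence it
   is below the degree of [p x]. *)
pose sib x := enum [set z | (0 < dep z) && (p z == p x)].
have sibx x : 0 < dep x -> x \in sib x by rewrite mem_enum inE eqxx andbT.
apply: (tree_order_defines (col := fun x => index x (sib x)) dep0 depS e_par eP).
  move=> x y dx dy Exy; have Es : sib x = sib y by rewrite /sib Exy.
  by rewrite Es; apply: index_inj; rewrite ?sibx // -Es sibx.
move=> x dx; apply: leq_trans (Hd _ _ Ce).
apply: (@leq_trans (degree e (p x))); last exact: leq_bigmax.
apply: (@leq_trans (size (sib x))); first by rewrite index_mem sibx.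
rewrite -cardE; apply: subset_leq_card; apply/subsetP => z; rewrite !inE.
by case/andP=> dz /eqP <-; rewrite es e_par.
Qed.

Theorem theorem4p8 (C : graph_class)
  (HC : forall (T : finType) (e : rel T), C T e -> is_tree e) :
  [<-> MSO1_orderable C; MSO2_orderable C; has_SEP C; bounded_degree C].
Proof.
have HG (T : finType) (e : rel T) : C T e -> is_graph e /\ 0 < #|T|.
  by move=> /HC[].
tfae.
- exact: MSO1_orderable_MSO2_orderable.
- exact: MSO2_orderable_SEP.
- exact: SEP_bounded_degree.
- exact: bounded_degree_MSO1_orderable.
Qed.
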